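(* Let $H$ be a Hopf algebra over a field $\Bbbk$. Let $A$ and $B$ be two partial $H$-module algebras with symmetrical partial actions, and suppose these partial actions are Morita equivalent. Then the global actions of $H$ on the standard globalizations of $A$ and $B$ are also Morita equivalent.
   Context: Algebras are associative $\Bbbk$-algebras, not necessarily unital; $\Delta(h)=\sum h_{(1)}\otimes h_{(2)}$. A partial action of $H$ on $A$ is a linear map $\cdot:H\otimes A\to A$ with, for all $a,b\in A$, $h,k\in H$: $1_H\cdot a=a$ and $h\cdot(a(k\cdot b))=\sum(h_{(1)}\cdot a)(h_{(2)}k\cdot b)$; $A$ is then a partial $H$-module algebra. It is symmetrical if also $h\cdot((k\cdot b)a)=\sum(h_{(1)}k\cdot b)(h_{(2)}\cdot a)$. Every (possibly nonunital) $H$-module algebra is a partial $H$-module algebra; its action is then called global. Standard globalization: for a symmetrical partial action on $A$, let $\varphi_A:A\to\operatorname{Hom}_\Bbbk(H,A)$, $\varphi_A(a)(h)=h\cdot a$, where $\operatorname{Hom}_\Bbbk(H,A)$ has the convolution product and the $H$-module algebra structure $(k\triangleright f)(h)=f(hk)$. The standard globalization of $A$ is the pair $(H\triangleright\varphi_A(A),\varphi_A)$, where $H\triangleright\varphi_A(A)$ is the span of all $h\triangleright\varphi_A(a)$, an $H$-module subalgebra with action $\triangleright$. A Morita context $(A,B,{}_AM_B,{}_BN_A,\tau,\sigma)$ consists of algebras $A,B$, bimodules $M,N$, and bimodule maps $\tau:M\otimes_BN\to A$, $\sigma:N\otimes_AM\to B$ with $\tau(m\otimes n)m'=m\,\sigma(n\otimes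 m')$ and $\sigma(n\otimes m)n'=n\,\tau(m\otimes n')$; it is strict if $\tau,\sigma$ are surjective. A bimodule ${}_AM_B$ is unital if $AM=M=MB$. The context algebra is $C=\begin{pmatrix}A&M\\N&B\end{pmatrix}$ with matrix multiplication defined via the bimodule structures, $\tau$ and $\sigma$. Partial actions $\cdot_A$ on $A$ and $\cdot_B$ on $B$ (in particular, global actions) are Morita equivalent if: (1) there is a strict Morita context $(A,B,{}_AM_B,{}_BN_A,\tau,\sigma)$ with $M,N$ unital bimodules; (2) there is a partial action of $H$ on the context algebra $C$ whose restrictions to $\begin{pmatrix}A&0\\0&0\end{pmatrix}$ and $\begin{pmatrix}0&0\\0&B\end{pmatrix}$ coincide with $\cdot_A$ and $\cdot_B$ respectively. *)

(* Defs.v *)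
From HB Require Import structures.
From mathcomp Require Import all_boot all_order all_algebra.
From mathcomp Require Import generic_quotient sesquilinear.
From mathcomp Require Import boolp functions.

Set Implicit Arguments.
Unset Strict Implicit.
Unset Printing Implicit Defensive.

Import GRing.Theory.
Local Open Scope ring_scope.
Local Open Scope quotient_scope.

Section BalancedTensor.
Context {k : fieldType} {B : Type} {V W : lmodType k}.
Variables (rV : B -> {linear V -> V}) (lW : B -> {linear W -> W}).

(* Formal sums of pure tensors, as lists of pairs, modulo the congruence
   generated by bilinearity and by [v b (x) w = v (x) b w], where [rV b v] is
   read as [v b] and [lW b w] as [b w]. *)
Inductive tens_rel : seq (V * W) -> seq (V * W) -> Prop :=
| tens_refl s : tens_rel s s
| tens_sym s t : tens_rel s t -> tens_rel t s
| tens_trans s t u : tens_rel s t -> tens_rel t u -> tens_rel s u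
| tens_cat s s' t t' :
    tens_rel s s' -> tens_rel t t' -> tens_rel (s ++ t) (s' ++ t')
| tens_catC s t : tens_rel (s ++ t) (t ++ s)
| tens_0l w : tens_rel [:: (0, w)] [::]
| tens_Dl v v' w : tens_rel [:: (v + v', w)] [:: (v, w); (v', w)]
| tens_Dr v w w' : tens_rel [:: (v, w + w')] [:: (v, w); (v, w')]
| tens_Z c v w : tens_rel [:: (c *: v, w)] [:: (v, c *: w)]
| tens_bal v b w : tens_rel [:: (rV b v, w)] [:: (v, lW b w)].

Definition tens_relb : rel (seq (V * W)) := fun s t => `[< tens_rel s t >].

Lemma tens_relb_refl : reflexive tens_relb.
Proof. by move=> s; apply/asboolP; exact: tens_refl. Qed.

Lemma tens_relb_sym : symmetric tens_relb.
Proof. by move=> s t; apply/asboolP/asboolP; exact: tens_sym. Qed.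

Lemma tens_relb_trans : transitive tens_relb.
Proof.
move=> t s u /asboolP st /asboolP tu; apply/asboolP; exact: tens_trans st tu.
Qed.

Canonical tens_equiv :=
  EquivRel tens_relb tens_relb_refl tens_relb_sym tens_relb_trans.

Definition btens : Type := {eq_quot tens_equiv}.
HB.instance Definition _ := Choice.on btens.
HB.instance Definition _ := EqQuotient.on btens.

Lemma btens_eqP (s t : seq (V * W)) :
  \pi_btens s = \pi_btens t <-> tens_rel s t.
Proof.
by split=> [/eqmodP/asboolP//|st]; apply/eqmodP/asboolP.
Qed.

Lemma btensW (P : btens -> Prop) :
  (forall s, P (\pi_btens s)) -> forall x, P x.
Proof. by move=> Ps x; rewrite -[x]reprK. Qed.

Definition pure (v : V) (w : W) : btens := \pi_btens [:: (v, w)].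

Definition tens_add (x y : btens) : btens := \pi_btens (repr x ++ repr y).
Definition tens_scale (c : k) (x : btens) : btens :=
  \pi_btens [seq (c *: p.1, p.2) | p <- repr x].
Definition tens_opp (x : btens) : btens := tens_scale (-1) x.
Definition tens_zero : btens := \pi_btens [::].

Lemma tens_addE s t :
  tens_add (\pi_btens s) (\pi_btens t) = \pi_btens (s ++ t).
Proof.
by apply/btens_eqP; apply: tens_cat; apply/btens_eqP; rewrite reprK.
Qed.


Lemma tens_rel_scale (c : k) s t : tens_rel s t ->
  tens_rel [seq (c *: p.1, p.2) | p <- s] [seq (c *: p.1, p.2) | p <- t].
Proof.
elim=> {s t}.
- by move=> s; exact: tens_refl.
- by move=> s t _; exact: tens_sym.
- by move=> s t u _ + _; exact: tens_trans.
- by move=> s s' t t' _ IH _ IH'; rewrite !map_cat; exact: tens_cat.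
- by move=> s t; rewrite !map_cat; exact: tens_catC.
- by move=> w /=; rewrite scaler0; exact: tens_0l.
- by move=> v v' w /=; rewrite scalerDr; exact: tens_Dl.
- by move=> v w w' /=; exact: tens_Dr.
- by move=> a v w /=; rewrite scalerA mulrC -scalerA; exact: tens_Z.
- by move=> v b w /=; rewrite -linearZ; exact: tens_bal.
Qed.

Lemma tens_scaleE c s :
  tens_scale c (\pi_btens s) = \pi_btens [seq (c *: p.1, p.2) | p <- s].
Proof.
by apply/btens_eqP; apply: tens_rel_scale; apply/btens_eqP; rewrite reprK.
Qed.

Lemma tens_addA : associative tens_add.
Proof.
move=> x y z; elim/btensW: x => s; elim/btensW: y => t; elim/btensW: z => u.
by rewrite !tens_addE catA.
Qed.

Lemma tens_addC : commutative tens_add.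
Proof.
move=> x y; elim/btensW: x => s; elim/btensW: y => t; rewrite !tens_addE.
by apply/btens_eqP; exact: tens_catC.
Qed.

Lemma tens_add0 : left_id tens_zero tens_add.
Proof. move=> x; elim/btensW: x => s; by rewrite tens_addE. Qed.

Lemma tens_addN : left_inverse tens_zero tens_opp tens_add.
Proof.
move=> x; elim/btensW: x => s; rewrite /tens_opp tens_scaleE tens_addE; apply/btens_eqP.
elim: s => [|[v w] s IH]; first exact: tens_refl.
rewrite map_cons cat_cons -cat1s -(cat1s (v, w)) catA.
have swap u : tens_rel (u ++ [:: (v, w)] ++ s) ([:: (v, w)] ++ u ++ s).
  by rewrite !catA; apply: tens_cat (tens_catC _ _) (tens_refl _).
rewrite -catA; apply: tens_trans (tens_cat (tens_refl _) (swap _)) _.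
have N : tens_rel [:: (-1 *: v, w); (v, w)] [::].
  apply: tens_trans (tens_0l w); apply: tens_sym.
  by rewrite -[X in (X, w)](addNr v) -scaleN1r; exact: tens_Dl.
exact: (tens_cat N IH).
Qed.

HB.instance Definition _ :=
  GRing.isZmodule.Build btens tens_addA tens_addC tens_add0 tens_addN.

Lemma pi_btensD s t : \pi_btens s + \pi_btens t = \pi_btens (s ++ t).
Proof. exact: tens_addE. Qed.

Lemma tens_scaleA a b x :
  tens_scale a (tens_scale b x) = tens_scale (a * b) x.
Proof.
elim/btensW: x => s; rewrite !tens_scaleE -map_comp; congr (\pi_ _ _).
by apply: eq_map => p /=; rewrite scalerA.
Qed.

Lemma tens_scale1 : left_id 1 tens_scale.
Proof.
move=> x; elim/btensW: x => s; rewrite tens_scaleE -[in RHS](map_id s); congr (\pi_ _ _).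
by apply: eq_map => -[v w] /=; rewrite scale1r.
Qed.

Lemma tens_scaleDr : right_distributive tens_scale +%R.
Proof.
move=> c x y; elim/btensW: x => s; elim/btensW: y => t.
by rewrite pi_btensD !tens_scaleE pi_btensD map_cat.
Qed.

Lemma tens_scaleDl x : {morph tens_scale^~ x : a b / a + b}.
Proof.
elim/btensW: x => s a b; rewrite !tens_scaleE pi_btensD.
apply/btens_eqP; elim: s => [|[v w] s IH]; first exact: tens_refl.
rewrite !map_cons cat_cons -cat1s.
apply: tens_trans (tens_cat (tens_refl _) IH) _.
have Dl : tens_rel [:: ((a + b) *: v, w)] [:: (a *: v, w); (b *: v, w)].
  by rewrite scalerDl; exact: tens_Dl.
apply: tens_trans (tens_cat Dl (tens_refl _)) _ => /=.
rewrite -cat1s -[X in tens_rel _ X]cat1s; apply: tens_cat (tens_refl _) _.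
rewrite -cat1s catA -[X in tens_rel _ (_ ++ X)]cat1s [X in tens_rel _ X]catA.
exact: tens_cat (tens_catC _ _) (tens_refl _).
Qed.

HB.instance Definition _ := GRing.Zmodule_isLmodule.Build k btens
  tens_scaleA tens_scale1 tens_scaleDr tens_scaleDl.

Lemma pi_btens s : \pi_btens s = \sum_(p <- s) pure p.1 p.2.
Proof.
elim: s => [|[v w] s IH]; first by rewrite big_nil.
by rewrite big_cons -IH pi_btensD.
Qed.

Lemma sum_repr_btens (x : btens) : \sum_(p <- repr x) pure p.1 p.2 = x.
Proof. by rewrite -pi_btens reprK. Qed.

Lemma pureDl v v' w : pure (v + v') w = pure v w + pure v' w.
Proof. by rewrite pi_btensD; apply/btens_eqP; exact: tens_Dl. Qed.

Lemma pureDr v w w' : pure v (w + w') = pure v w + pure v w'.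
Proof. by rewrite pi_btensD; apply/btens_eqP; exact: tens_Dr. Qed.

Lemma pureZl c v w : pure (c *: v) w = c *: pure v w.
Proof. by rewrite [RHS]tens_scaleE. Qed.

Lemma pureZr c v w : pure v (c *: w) = c *: pure v w.
Proof.
by rewrite -pureZl; apply/btens_eqP/tens_sym; exact: tens_Z.
Qed.

Lemma pure_bal v b w : pure (rV b v) w = pure v (lW b w).
Proof. by apply/btens_eqP; exact: tens_bal. Qed.

Section Lift.
Context {X : lmodType k}.
Variable f : V -> W -> X.

Definition tlift (x : btens) : X := \sum_(p <- repr x) f p.1 p.2.

Hypothesis fbil : bilinear_for *:%R *:%R f.
Hypothesis fbal : forall v b w, f (rV b v) w = f v (lW b w).

Let fDl v v' w : f (v + v') w = f v w + f v' w.
Proof. by have /= := fbil.1 w 1 v v'; rewrite !scale1r. Qed.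

Let fDr v w w' : f v (w + w') = f v w + f v w'.
Proof. by have /= := fbil.2 v 1 w w'; rewrite !scale1r. Qed.

Let f0l w : f 0 w = 0.
Proof. by apply: (addrI (f 0 w)); rewrite -fDl !addr0. Qed.

Let f0r v : f v 0 = 0.
Proof. by apply: (addrI (f v 0)); rewrite -fDr !addr0. Qed.

Let fZl c v w : f (c *: v) w = c *: f v w.
Proof. by have := fbil.1 w c v 0; rewrite /= f0l !addr0. Qed.

Let fZr c v w : f v (c *: w) = c *: f v w.
Proof. by have := fbil.2 v c w 0; rewrite /= f0r !addr0. Qed.

Lemma tlift_pi s : tlift (\pi_btens s) = \sum_(p <- s) f p.1 p.2.
Proof.
have: tens_rel (repr (\pi_btens s)) s by apply/btens_eqP; rewrite reprK.
rewrite /tlift; move: (repr _) => r; elim=> {r s} //.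
- by move=> s t u _ -> _ ->.
- by move=> s s' t t' _ IH _ IH'; rewrite !big_cat /= IH IH'.
- by move=> s t; rewrite !big_cat /= addrC.
- by move=> w; rewrite big_seq1 big_nil /= f0l.
- by move=> v v' w; rewrite !big_cons !big_nil /= !addr0 fDl.
- by move=> v w w'; rewrite !big_cons !big_nil /= !addr0 fDr.
- by move=> c v w; rewrite !big_seq1 /= fZl fZr.
- by move=> v b w; rewrite !big_seq1 /= fbal.
Qed.

Lemma tlift_pure v w : tlift (pure v w) = f v w.
Proof. by rewrite tlift_pi big_seq1. Qed.

Lemma tlift_linear : linear tlift.
Proof.
move=> c x y; elim/btensW: x => s; elim/btensW: y => t.
rewrite [_ *: _]tens_scaleE pi_btensD !tlift_pi big_cat big_map /= scaler_sumr.
by congr (_ + _); apply: eq_bigr => p _; rewrite fZl.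
Qed.

End Lift.

End BalancedTensor.

Definition tens_void {k : fieldType} {V : lmodType k} (b : void) :
  {linear V -> V} := match b with end.

(* The plain tensor product over the field [k] has no balancing relation. *)
Definition tens {k : fieldType} (V W : lmodType k) : Type :=
  btens (@tens_void k V) (@tens_void k W).
HB.instance Definition _ (k : fieldType) (V W : lmodType k) :=
  GRing.Lmodule.on (tens V W).

Definition tpure {k : fieldType} {V W : lmodType k} (v : V) (w : W) :
  tens V W := pure tens_void tens_void v w.

Notation "v '⊗t' w" := (tpure v w) (at level 40, left associativity) : ring_scope.

(* Sums over [repr (comul h)] are Sweedler sums: [repr] picks a formal sum
   \sum h_(1) ⊗ h_(2) representing [comul h]. *)
HB.mixin Record Algebra_isHopf (k : fieldType) H of GRing.Algebra k H := {
  comul : {linear H -> tens H H};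
  counit : {lrmorphism H -> k | *%R};
  antipode : {linear H -> H};
  comul1 : comul 1 = 1 ⊗t 1;
  comulM : forall g h : H, comul (g * h) =
    \sum_(p <- repr (comul g)) \sum_(q <- repr (comul h))
      (p.1 * q.1) ⊗t (p.2 * q.2);
  comulA : forall h : H,
    \sum_(p <- repr (comul h)) \sum_(q <- repr (comul p.1))
      q.1 ⊗t (q.2 ⊗t p.2) =
    \sum_(p <- repr (comul h)) p.1 ⊗t comul p.2;
  counitl : forall h : H,
    \sum_(p <- repr (comul h)) counit p.1 *: p.2 = h;
  counitr : forall h : H,
    \sum_(p <- repr (comul h)) counit p.2 *: p.1 = h;
  antipodel : forall h : H,
    \sum_(p <- repr (comul h)) antipode p.1 * p.2 = (counit h)%:A;
  antipoder : forall h : H,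
    \sum_(p <- repr (comul h)) p.1 * antipode p.2 = (counit h)%:A
}.
#[short(type="hopfType")]
HB.structure Definition Hopf (k : fieldType) :=
  {H of GRing.Algebra k H & Algebra_isHopf k H}.

HB.mixin Record Lmodule_isNualg (k : fieldType) A of GRing.Lmodule k A := {
  nmul : A -> A -> A;
  nmulA : associative nmul;
  nmulDl : left_distributive nmul +%R;
  nmulDr : right_distributive nmul +%R;
  nmulZl : forall (c : k) (a b : A), nmul (c *: a) b = c *: nmul a b;
  nmulZr : forall (c : k) (a b : A), nmul a (c *: b) = c *: nmul a b
}.
(* Associative, not necessarily unital, k-algebras. *)
#[short(type="nualgType")]
HB.structure Definition Nualg (k : fieldType) :=
  {A of GRing.Lmodule k A & Lmodule_isNualg k A}.

Notation "a ** b" := (nmul a b) (at level 40, left associativity) : ring_scope.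

Definition bilin_of (k : fieldType) (U V W : lmodType k) (f : U -> V -> W)
    (fb : bilinear_for *:%R *:%R f) : {bilinear U -> V -> W} :=
  HB.pack f (bilinear_isBilinear.Build k U V W *:%R *:%R f fb).

Lemma nmul_bilinear (k : fieldType) (A : nualgType k) :
  bilinear_for *:%R *:%R (@nmul k A).
Proof.
by split=> w a u v /=; rewrite ?nmulDl ?nmulDr ?nmulZl ?nmulZr.
Qed.
HB.instance Definition _ (k : fieldType) (A : nualgType k) :=
  bilinear_isBilinear.Build k A A A *:%R *:%R (@nmul k A) (nmul_bilinear A).

Lemma nmul_suml (k : fieldType) (A : nualgType k) I (r : seq I) (F : I -> A) b :
  (\sum_(i <- r) F i) ** b = \sum_(i <- r) F i ** b.
Proof. exact: linear_sumlz. Qed.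

Lemma nmul_sumr (k : fieldType) (A : nualgType k) I (r : seq I) (F : I -> A) b :
  b ** (\sum_(i <- r) F i) = \sum_(i <- r) b ** F i.
Proof. exact: linear_sumr. Qed.

(* [sw h] is a list of pairs (h_(1), h_(2)) with [comul h = \sum h_(1) ⊗ h_(2)].
   It is a choice of representative: sums of expressions that are bilinear in
   the two components do not depend on it (lemma [sw_sum]). *)
Definition sw {k : fieldType} {H : hopfType k} (h : H) : seq (H * H) :=
  repr (comul h).

Section Sweedler.
Context {k : fieldType} {H : hopfType k} {X : lmodType k}.

Lemma sw_sum (f : H -> H -> X) h (s : seq (H * H)) :
    bilinear_for *:%R *:%R f -> comul h = \sum_(p <- s) p.1 ⊗t p.2 ->
  \sum_(p <- sw h) f p.1 p.2 = \sum_(p <- s) f p.1 p.2.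
Proof.
move=> fb hs; have fbal : forall v (b : void) w,
  f (tens_void b v) w = f v (tens_void b w) by move=> v [].
by rewrite -(tlift_pi fb fbal s) pi_btens /sw hs.
Qed.

Lemma sw_linear (f : H -> H -> X) : bilinear_for *:%R *:%R f ->
  linear (fun h => \sum_(p <- sw h) f p.1 p.2).
Proof.
move=> fb c g h /=; have fbal : forall v (b : void) w,
  f (tens_void b v) w = f v (tens_void b w) by move=> v [].
rewrite /sw linearP; exact: (tlift_linear fb fbal).
Qed.

Lemma sw_sumA (T : H -> H -> H -> X) h :
    (forall y z, linear (fun x => T x y z)) ->
    (forall x z, linear (fun y => T x y z)) ->
    (forall x y, linear (T x y)) ->
  \sum_(p <- sw h) \sum_(q <- sw p.1) T q.1 q.2 p.2 =
  \sum_(p <- sw h) \sum_(q <- sw p.2) T p.1 q.1 q.2.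
Proof.
move=> T1 T2 T3.
have Tb x : bilinear_for *:%R *:%R (T x) by split=> ?; [exact: T2|exact: T3].
have Tbal x v (b : void) w : T x (tens_void b v) w = T x v (tens_void b w).
  by case: b.
pose G x (t : tens H H) := tlift (T x) t.
have Gb : bilinear_for *:%R *:%R G.
  split=> [t|x] c u v /=; last exact: (tlift_linear (Tb x) (Tbal x)).
  rewrite /G /tlift scaler_sumr -big_split /=; apply: eq_bigr => p _.
  exact: T1.
have Gbal v (b : void) w : G (tens_void b v) w = G v (tens_void b w).
  by case: b.
pose L (t : tens H (tens H H)) := tlift G t.
have Llin : linear L := tlift_linear Gb Gbal.
pose L' : {linear tens H (tens H H) -> X} :=
  HB.pack L (GRing.isLinear.Build k _ _ _ L Llin).
have Lsum (r : seq (H * H)) F : L (\sum_(i <- r) F i) = \sum_(i <- r) L (F i).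
  exact: (linear_sum L').
have := congr1 L (comulA h); rewrite !Lsum => hL.
transitivity (\sum_(p <- sw h) L (p.1 ⊗t comul p.2)); last first.
  by apply: eq_bigr => p _; rewrite /L (tlift_pure Gb Gbal).
rewrite -{}hL; apply: eq_bigr => p _; rewrite Lsum; apply: eq_bigr => q _.
by rewrite /L (tlift_pure Gb Gbal) /G (tlift_pure (Tb _) (Tbal _)).
Qed.

End Sweedler.

Section PartialActions.
Context {k : fieldType}.

(* The linear map H ⊗ A -> A is given as a bilinear map. *)
Record paction (H : hopfType k) (A : nualgType k) := PAction {
  pact :> {bilinear H -> A -> A};
  pact1 : forall a, pact 1 a = a;
  pactM : forall h g a b, pact h (a ** pact g b) =
    \sum_(p <- sw h) pact p.1 a ** pact (p.2 * g) b
}.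

Definition symmetrical H A (act : paction H A) : Prop :=
  forall h g a b, act h (act g b ** a) =
    \sum_(p <- sw h) act (p.1 * g) b ** act p.2 a.

(* A is an H-module algebra. *)
Definition is_global H A (act : paction H A) : Prop :=
  (forall g h a, act g (act h a) = act (g * h) a) /\
  (forall h a b, act h (a ** b) = \sum_(p <- sw h) act p.1 a ** act p.2 b).

End PartialActions.

Definition Hom {k : fieldType} (V W : lmodType k) : Type := {linear V -> W}.

Section HomLmod.
Context {k : fieldType} {V W : lmodType k}.
Implicit Types f g : Hom V W.

HB.instance Definition _ := gen_eqMixin (Hom V W).
HB.instance Definition _ := gen_choiceMixin (Hom V W).

Definition mkHom (f : V -> W) (lf : linear f) : Hom V W :=
  HB.pack f (GRing.isLinear.Build k V W _ f lf).

Lemma homP f g : (forall v, f v = g v) <-> f = g.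
Proof.
split=> [|-> //]; case: f g => [f [[f1] [f2]]] [g [[g1] [g2]]] /= fg.
have {fg} e : f = g by apply/funext.
case: _ / e in g1 g2 *.
by rewrite (Prop_irrelevance f1 g1) (Prop_irrelevance f2 g2).
Qed.

Lemma hom_add_linear f g : linear (fun v => f v + g v).
Proof. by move=> c u v; rewrite !linearP scalerDr addrACA. Qed.

Lemma hom_scale_linear (a : k) f : linear (fun v => a *: f v).
Proof. by move=> c u v; rewrite linearP scalerDr !scalerA mulrC. Qed.

Lemma hom_zero_linear : linear (fun _ : V => 0 : W).
Proof. by move=> c u v; rewrite scaler0 addr0. Qed.

Definition hom_add f g := mkHom (hom_add_linear f g).
Definition hom_scale a f := mkHom (hom_scale_linear a f).
Definition hom_zero := mkHom hom_zero_linear.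
Definition hom_opp f := hom_scale (-1) f.

Lemma hom_addA : associative hom_add.
Proof. by move=> f g h; apply/homP => v /=; rewrite addrA. Qed.
Lemma hom_addC : commutative hom_add.
Proof. by move=> f g; apply/homP => v /=; rewrite addrC. Qed.
Lemma hom_add0 : left_id hom_zero hom_add.
Proof. by move=> f; apply/homP => v /=; rewrite add0r. Qed.
Lemma hom_addN : left_inverse hom_zero hom_opp hom_add.
Proof. by move=> f; apply/homP => v /=; rewrite scaleN1r addNr. Qed.
HB.instance Definition _ :=
  GRing.isZmodule.Build (Hom V W) hom_addA hom_addC hom_add0 hom_addN.

Lemma hom_scaleA a b f : hom_scale a (hom_scale b f) = hom_scale (a * b) f.
Proof. by apply/homP => v /=; rewrite scalerA. Qed.
Lemma hom_scale1 : left_id 1 hom_scale.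
Proof. by move=> f; apply/homP => v /=; rewrite scale1r. Qed.
Lemma hom_scaleDr : right_distributive hom_scale +%R.
Proof. by move=> c f g; apply/homP => v /=; rewrite scalerDr. Qed.
Lemma hom_scaleDl f : {morph hom_scale^~ f : a b / a + b}.
Proof. by move=> a b; apply/homP => v /=; rewrite scalerDl. Qed.
HB.instance Definition _ := GRing.Zmodule_isLmodule.Build k (Hom V W)
  hom_scaleA hom_scale1 hom_scaleDr hom_scaleDl.

Lemma homD f g v : (f + g) v = f v + g v. Proof. by []. Qed.
Lemma homZ (c : k) f v : (c *: f) v = c *: f v. Proof. by []. Qed.
Lemma hom_sumE I (r : seq I) (F : I -> Hom V W) v :
  (\sum_(i <- r) F i) v = \sum_(i <- r) F i v.
Proof. by elim/big_rec2: _ => // i y x _ <-. Qed.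

End HomLmod.

Section Convolution.
Context {k : fieldType} {H : hopfType k} {A : nualgType k}.
Implicit Types f g : Hom H A.

Lemma conv_bilinear f g : bilinear_for *:%R *:%R (fun x y => f x ** g y).
Proof.
by split=> w c u v /=; rewrite linearP ?nmulDl ?nmulDr ?nmulZl ?nmulZr.
Qed.

Lemma conv_linear f g : linear (fun h => \sum_(p <- sw h) f p.1 ** g p.2).
Proof. exact: sw_linear (conv_bilinear f g). Qed.

Definition conv f g : Hom H A := mkHom (conv_linear f g).

Lemma convE f g h : conv f g h = \sum_(p <- sw h) f p.1 ** g p.2.
Proof. by []. Qed.

Lemma convA : associative conv.
Proof.
move=> f g l; apply/homP => h; rewrite !convE.
under eq_bigr do rewrite convE nmul_sumr.
under [RHS]eq_bigr do rewrite convE nmul_suml.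
rewrite (sw_sumA (T := fun x y z => f x ** g y ** l z)).
- by apply: eq_bigr => p _; apply: eq_bigr => q _; rewrite nmulA.
- by move=> y z c u v /=; rewrite linearP !nmulDl !nmulZl.
- by move=> y z c u v /=; rewrite linearP nmulDr nmulZr !nmulDl !nmulZl.
- by move=> y z c u v /=; rewrite linearP nmulDr nmulZr.
Qed.

Lemma convDl : left_distributive conv +%R.
Proof.
move=> f g l; apply/homP => h; rewrite homD !convE -big_split.
by apply: eq_bigr => p _; rewrite homD nmulDl.
Qed.
Lemma convDr : right_distributive conv +%R.
Proof.
move=> f g l; apply/homP => h; rewrite homD !convE -big_split.
by apply: eq_bigr => p _; rewrite homD nmulDr.
Qed.
Lemma convZl (c : k) f g : conv (c *: f) g = c *: conv f g.
Proof.
apply/homP => h; rewrite homZ !convE scaler_sumr.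
by apply: eq_bigr => p _; rewrite homZ nmulZl.
Qed.
Lemma convZr (c : k) f g : conv f (c *: g) = c *: conv f g.
Proof.
apply/homP => h; rewrite homZ !convE scaler_sumr.
by apply: eq_bigr => p _; rewrite homZ nmulZr.
Qed.

HB.instance Definition _ := GRing.Lmodule.on (Hom H A).
HB.instance Definition _ := Lmodule_isNualg.Build k (Hom H A)
  convA convDl convDr convZl convZr.

(* [hact g f] is g ▷ f. *)
Lemma hact_linear (g : H) f : linear (fun h => f (h * g)).
Proof. by move=> c u v; rewrite mulrDl -scalerAl linearP. Qed.

Definition hact (g : H) f : Hom H A := mkHom (hact_linear g f).

Lemma hactE (g : H) f (h : H) : hact g f h = f (h * g). Proof. by []. Qed.

Lemma hact_bilinear : bilinear_for *:%R *:%R hact.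
Proof.
split=> [f|g] c u v; apply/homP => h; rewrite homD homZ !hactE //.
by rewrite mulrDr -scalerAr linearP.
Qed.
HB.instance Definition _ :=
  bilinear_isBilinear.Build k H (Hom H A) (Hom H A) *:%R *:%R hact hact_bilinear.

Lemma hact1 f : hact 1 f = f.
Proof. by apply/homP => h; rewrite hactE mulr1. Qed.

Lemma hactA (g h : H) f : hact g (hact h f) = hact (g * h) f.
Proof. by apply/homP => l; rewrite !hactE mulrA. Qed.

Lemma hactM (h : H) f g :
  hact h (f ** g) = \sum_(p <- sw h) hact p.1 f ** hact p.2 g.
Proof.
apply/homP => l; rewrite hom_sumE hactE convE.
rewrite (sw_sum (f := fun x y => f x ** g y)
  (s := [seq (p.1 * q.1, p.2 * q.2) | p <- sw l, q <- sw h])).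
- rewrite big_allpairs_dep exchange_big /=; exact: eq_bigr.
- exact: conv_bilinear.
- by rewrite comulM big_allpairs_dep.
Qed.

End Convolution.

Section Globalization.
Context {k : fieldType} {H : hopfType k} {A : nualgType k}.
Variable act : paction H A.

Lemma phi_linear_r (a : A) : linear (fun h => act h a).
Proof. by move=> c u v; rewrite linearPl. Qed.

(* The map φ_A : A -> Hom(H, A). *)
Definition phi (a : A) : Hom H A := mkHom (phi_linear_r a).

Lemma phiE a h : phi a h = act h a. Proof. by []. Qed.

Lemma phi_linear : linear phi.
Proof. by move=> c a b; apply/homP => h; rewrite homD homZ !phiE linearPr. Qed.
HB.instance Definition _ :=
  GRing.isLinear.Build k A (Hom H A) *:%R phi phi_linear.

Lemma phi_hact a h b : phi a ** hact h (phi b) = phi (a ** act h b).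
Proof. by apply/homP => l; rewrite phiE pactM. Qed.

Lemma hact_phi_mul h a g b : hact h (phi a) ** hact g (phi b) =
  \sum_(p <- sw h) hact p.1 (phi (a ** act (antipode p.2 * g) b)).
Proof.
have -> : \sum_(p <- sw h) hact p.1 (phi (a ** act (antipode p.2 * g) b)) =
    \sum_(p <- sw h) \sum_(q <- sw p.1)
      hact q.1 (phi a) ** hact (q.2 * (antipode p.2 * g)) (phi b).
  apply: eq_bigr => p _; rewrite -phi_hact hactM; apply: eq_bigr => q _.
  by rewrite hactA.
rewrite (sw_sumA
  (T := fun x y z => hact x (phi a) ** hact (y * (antipode z * g)) (phi b))).
- have -> : hact h (phi a) =
      \sum_(p <- sw h) counit p.2 *: hact p.1 (phi a).
    rewrite -[in LHS](counitr h) linear_sumlz.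
    by apply: eq_bigr => p _; rewrite linearZl_LR.
  rewrite nmul_suml; apply: eq_bigr => p _.
  rewrite -nmul_sumr nmulZl -nmulZr; congr (_ ** _).
  rewrite -linear_sumlz /=; under eq_bigr do rewrite mulrA.
  by rewrite -mulr_suml antipoder -scalerAl mul1r linearZl_LR.
- by move=> y z c u v /=; rewrite linearPl nmulDl nmulZl.
- by move=> y z c u v /=; rewrite mulrDl -scalerAl linearPl nmulDr nmulZr.
- move=> y z c u v /=.
  by rewrite linearP mulrDl mulrDr -scalerAl -scalerAr linearPl nmulDr nmulZr.
Qed.

(* [glob_pred] is H ▷ φ_A(A); scalars are absorbed by the elements of H. *)
Definition glob_pred : {pred Hom H A} := fun f =>
  `[< exists s : seq (H * A), f = \sum_(p <- s) hact p.1 (phi p.2) >].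

Lemma glob_predP f : reflect
  (exists s : seq (H * A), f = \sum_(p <- s) hact p.1 (phi p.2))
  (f \in glob_pred).
Proof. exact: asboolP. Qed.

Lemma glob_submod : GRing.submod_closed glob_pred.
Proof.
split=> [|c f g]; first by apply/glob_predP; exists [::]; rewrite big_nil.
move=> /glob_predP[s ->] /glob_predP[t ->]; apply/glob_predP.
exists ([seq (c *: p.1, p.2) | p <- s] ++ t).
rewrite big_cat big_map scaler_sumr /=; congr (_ + _).
by apply: eq_bigr => p _; rewrite linearZl_LR.
Qed.
HB.instance Definition _ :=
  GRing.isSubmodClosed.Build k (Hom H A) glob_pred glob_submod.

Lemma glob_hact h f : f \in glob_pred -> hact h f \in glob_pred.
Proof.
move=> /glob_predP[s ->]; apply/glob_predP.
exists [seq (h * p.1, p.2) | p <- s]; rewrite big_map linear_sumr.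
by apply: eq_bigr => p _; exact: hactA.
Qed.

Lemma hact_phi_in h a : hact h (phi a) \in glob_pred.
Proof. by apply/glob_predP; exists [:: (h, a)]; rewrite big_seq1. Qed.

Lemma glob_mul f g :
  f \in glob_pred -> g \in glob_pred -> f ** g \in glob_pred.
Proof.
move=> /glob_predP[s ->] /glob_predP[t ->].
rewrite nmul_suml rpred_sum // => p _; rewrite nmul_sumr rpred_sum // => q _.
by rewrite hact_phi_mul rpred_sum // => r _; exact: hact_phi_in.
Qed.

(* The algebra of the standard globalization of A. *)
Record glob := Glob { gval :> Hom H A; _ : gval \in glob_pred }.
HB.instance Definition _ := [isSub for gval].
HB.instance Definition _ := [Choice of glob by <:].
HB.instance Definition _ := [SubChoice_isSubLmodule of glob by <:].

Definition gmul (f g : glob) : glob := Glob (glob_mul (valP f) (valP g)).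

Lemma gmulA : associative gmul.
Proof. by move=> f g l; apply/val_inj; exact: nmulA. Qed.
Lemma gmulDl : left_distributive gmul +%R.
Proof. by move=> f g l; apply/val_inj; exact: nmulDl. Qed.
Lemma gmulDr : right_distributive gmul +%R.
Proof. by move=> f g l; apply/val_inj; exact: nmulDr. Qed.
Lemma gmulZl (c : k) f g : gmul (c *: f) g = c *: gmul f g.
Proof. by apply/val_inj; exact: nmulZl. Qed.
Lemma gmulZr (c : k) f g : gmul f (c *: g) = c *: gmul f g.
Proof. by apply/val_inj; exact: nmulZr. Qed.
HB.instance Definition _ :=
  Lmodule_isNualg.Build k glob gmulA gmulDl gmulDr gmulZl gmulZr.

Definition gact (h : H) (f : glob) : glob := Glob (glob_hact h (valP f)).

Lemma gact_bilinear : bilinear_for *:%R *:%R gact.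
Proof.
split=> [f|h] c u v; apply/val_inj; [exact: linearPl|exact: linearPr].
Qed.

Lemma gact1 f : gact 1 f = f.
Proof. by apply/val_inj; exact: hact1. Qed.

Lemma gactA g h f : gact g (gact h f) = gact (g * h) f.
Proof. by apply/val_inj; exact: hactA. Qed.

Lemma gactM h (f g : glob) :
  gact h (f ** g) = \sum_(p <- sw h) gact p.1 f ** gact p.2 g.
Proof. by apply/val_inj; rewrite raddf_sum; exact: hactM. Qed.

Lemma gact_pactM h g (a b : glob) : gact h (a ** gact g b) =
  \sum_(p <- sw h) gact p.1 a ** gact (p.2 * g) b.
Proof. by rewrite gactM; apply: eq_bigr => p _; rewrite gactA. Qed.

Definition glob_act : paction H glob :=
  @PAction k H glob (bilin_of gact_bilinear) gact1 gact_pactM.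

Lemma glob_act_global : is_global glob_act.
Proof. by split; [exact: gactA|exact: gactM]. Qed.

End Globalization.

HB.mixin Record Lmodule_isBimodule (k : fieldType) (A B : nualgType k) M
    of GRing.Lmodule k M := {
  lact : A -> {linear M -> M};
  ract : B -> {linear M -> M};
  lact_linear : forall m, linear (fun a => lact a m);
  ract_linear : forall m, linear (fun b => ract b m);
  lactM : forall a a' m, lact (a ** a') m = lact a (lact a' m);
  ractM : forall b b' m, ract (b ** b') m = ract b' (ract b m);
  lact_ract : forall a b m, ract b (lact a m) = lact a (ract b m)
}.
#[short(type="bimodType")]
HB.structure Definition Bimodule (k : fieldType) (A B : nualgType k) :=
  {M of GRing.Lmodule k M & Lmodule_isBimodule k A B M}.

Notation "a '•l' m" := (lact a m) (at level 40, left associativity) : ring_scope.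
Notation "m '•r' b" := (ract b m) (at level 40, left associativity) : ring_scope.

Section Morita.
Context {k : fieldType}.

Definition unital (A B : nualgType k) (M : bimodType A B) : Prop :=
  (forall m : M, exists s : seq (A * M), m = \sum_(p <- s) p.1 •l p.2) /\
  (forall m : M, exists s : seq (M * B), m = \sum_(p <- s) p.1 •r p.2).

(* M ⊗_B N *)
Definition tensB (A B C : nualgType k) (M : bimodType A B) (N : bimodType B C)
  : Type := btens (@ract k A B M) (@lact k B C N).
HB.instance Definition _ A B C M N := GRing.Lmodule.on (@tensB A B C M N).

Definition tenspure (A B C : nualgType k) (M : bimodType A B)
    (N : bimodType B C) (m : M) (n : N) : tensB M N :=
  pure (@ract k A B M) (@lact k B C N) m n.
Local Notation "m '⊗b' n" := (tenspure m n) (at level 40).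

(* The bimodule structure of M ⊗_B N acts on the outer sides of pure tensors,
   which span it, so bimodule maps are specified on pure tensors. *)
Record morita_context (A B : nualgType k) := MoritaContext {
  mcM : bimodType A B;
  mcN : bimodType B A;
  mtau : {linear tensB mcM mcN -> A};
  msigma : {linear tensB mcN mcM -> B};
  mtau_l : forall a m n, mtau ((a •l m) ⊗b n) = a ** mtau (m ⊗b n);
  mtau_r : forall m n a, mtau (m ⊗b (n •r a)) = mtau (m ⊗b n) ** a;
  msigma_l : forall b n m, msigma ((b •l n) ⊗b m) = b ** msigma (n ⊗b m);
  msigma_r : forall n m b, msigma (n ⊗b (m •r b)) = msigma (n ⊗b m) ** b;
  mtau_sigma : forall m n m',
    mtau (m ⊗b n) •l m' = m •r msigma (n ⊗b m');
  msigma_tau : forall n m n',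
    msigma (n ⊗b m) •l n' = n •r mtau (m ⊗b n')
}.

Definition strict_mc A B (c : morita_context A B) : Prop :=
  (forall a, exists x, mtau c x = a) /\ (forall b, exists y, msigma c y = b).

(* The context algebra; [((a, m), (n, b))] is the matrix with rows (a, m) and
   (n, b). *)
Definition mc_alg A B (c : morita_context A B) : Type :=
  ((A * mcM c) * (mcN c * B))%type.

Section ContextAlgebra.
Context {A B : nualgType k}.
Variable c : morita_context A B.
HB.instance Definition _ := GRing.Lmodule.on (mc_alg c).

Definition mc_mul (x y : mc_alg c) : mc_alg c :=
  let: ((a, m), (n, b)) := x in let: ((a', m'), (n', b')) := y in
  ((a ** a' + mtau c (m ⊗b n'), a •l m' + m •r b'),
   (n •r a' + b •l n', msigma c (n ⊗b m') + b ** b')).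

Let tau_pure : bilinear_for *:%R *:%R (fun m n => mtau c (m ⊗b n)).
Proof.
split=> w a u v /=; rewrite /tenspure.
- by rewrite pureDl pureZl; exact: linearP.
- by rewrite pureDr pureZr; exact: linearP.
Qed.

Let sigma_pure : bilinear_for *:%R *:%R (fun n m => msigma c (n ⊗b m)).
Proof.
split=> w a u v /=; rewrite /tenspure.
- by rewrite pureDl pureZl; exact: linearP.
- by rewrite pureDr pureZr; exact: linearP.
Qed.

Let tau_bal m b n : mtau c ((m •r b) ⊗b n) = mtau c (m ⊗b (b •l n)).
Proof. by congr (mtau c _); exact: pure_bal. Qed.

Let sigma_bal n a m : msigma c ((n •r a) ⊗b m) = msigma c (n ⊗b (a •l m)).
Proof. by congr (msigma c _); exact: pure_bal. Qed.

Let addE (x y : mc_alg c) : x + y =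
  ((x.1.1 + y.1.1, x.1.2 + y.1.2), (x.2.1 + y.2.1, x.2.2 + y.2.2)).
Proof. by []. Qed.

Let scaleE (t : k) (x : mc_alg c) : t *: x =
  ((t *: x.1.1, t *: x.1.2), (t *: x.2.1, t *: x.2.2)).
Proof. by []. Qed.

Let lactPl t a a' m : (t *: a + a') •l m = t *: (a •l m) + a' •l m :> mcM c.
Proof. exact: lact_linear. Qed.
Let lactPl' t b b' n : (t *: b + b') •l n = t *: (b •l n) + b' •l n :> mcN c.
Proof. exact: lact_linear. Qed.
Let ractPr t b b' m : m •r (t *: b + b') = t *: (m •r b) + m •r b' :> mcM c.
Proof. exact: ract_linear. Qed.
Let ractPr' t a a' n : n •r (t *: a + a') = t *: (n •r a) + n •r a' :> mcN c.
Proof. exact: ract_linear. Qed.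

Lemma mc_mul_bilinear : bilinear_for *:%R *:%R mc_mul.
Proof.
have sh (V : lmodType k) (t : k) (x x' y y' : V) :
    t *: x + x' + (t *: y + y') = t *: (x + y) + (x' + y').
  by rewrite addrACA scalerDr.
split=> w t u v; rewrite addE scaleE; case: u => -[a m] [n b];
  case: v => -[a' m'] [n' b']; case: w => -[a0 m0] [n0 b0] /=;
  rewrite addE scaleE /=; congr ((_, _), (_, _)); rewrite -sh.
- by rewrite nmulDl nmulZl (tau_pure.1 n0 t m m').
- by rewrite lactPl linearP.
- by rewrite lactPl' linearP.
- by rewrite nmulDl nmulZl (sigma_pure.1 m0 t n n').
- by rewrite nmulDr nmulZr (tau_pure.2 m0 t n n').
- by rewrite ractPr linearP.
- by rewrite ractPr' linearP.
- by rewrite nmulDr nmulZr (sigma_pure.2 n0 t m m').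
Qed.

Lemma mc_mulA : associative mc_mul.
Proof.
have Dl (V W X : lmodType k) (f : V -> W -> X) : bilinear_for *:%R *:%R f ->
    forall v v' w, f (v + v') w = f v w + f v' w.
  by move=> fb v v' w; have /= := fb.1 w 1 v v'; rewrite !scale1r.
have Dr (V W X : lmodType k) (f : V -> W -> X) : bilinear_for *:%R *:%R f ->
    forall v w w', f v (w + w') = f v w + f v w'.
  by move=> fb v w w'; have /= := fb.2 v 1 w w'; rewrite !scale1r.
have lD a a' (m : mcM c) : (a + a') •l m = a •l m + a' •l m.
  by have := lactPl 1 a a' m; rewrite !scale1r.
have lD' b b' (n : mcN c) : (b + b') •l n = b •l n + b' •l n.
  by have := lactPl' 1 b b' n; rewrite !scale1r.
have rD b b' (m : mcM c) : m •r (b + b') = m •r b + m •r b'.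
  by have := ractPr 1 b b' m; rewrite !scale1r.
have rD' a a' (n : mcN c) : n •r (a + a') = n •r a + n •r a'.
  by have := ractPr' 1 a a' n; rewrite !scale1r.
move=> [[a m] [n b]] [[a' m'] [n' b']] [[a2 m2] [n2 b2]] /=.
congr ((_, _), (_, _)).
- rewrite nmulDr nmulDl (Dr _ _ _ _ tau_pure) (Dl _ _ _ _ tau_pure) /=.
  by rewrite nmulA mtau_l mtau_r tau_bal -!addrA; congr (_ + _); rewrite addrCA.
- rewrite linearD linearD rD lD /= lactM ractM -lact_ract -mtau_sigma.
  by rewrite -!addrA; congr (_ + _); rewrite addrCA.
- rewrite linearD linearD rD' lD' /= lactM ractM -lact_ract -msigma_tau.
  by rewrite -!addrA; congr (_ + _); rewrite addrCA.
- rewrite nmulDr nmulDl (Dr _ _ _ _ sigma_pure) (Dl _ _ _ _ sigma_pure) /=.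
  by rewrite nmulA msigma_l msigma_r sigma_bal -!addrA; congr (_ + _); rewrite addrCA.
Qed.

Let mulb : {bilinear mc_alg c -> mc_alg c -> mc_alg c} :=
  bilin_of mc_mul_bilinear.

Let mulDl : left_distributive mc_mul +%R.
Proof. by move=> x y z; exact: (linearDl mulb). Qed.

Let mulDr : right_distributive mc_mul +%R.
Proof. by move=> x y z; exact: (linearDr mulb). Qed.

Let mulZl (t : k) x y : mc_mul (t *: x) y = t *: mc_mul x y.
Proof. exact: (linearZl_LR mulb). Qed.

Let mulZr (t : k) x y : mc_mul x (t *: y) = t *: mc_mul x y.
Proof. exact: (linearZr_LR mulb). Qed.

HB.instance Definition _ := Lmodule_isNualg.Build k (mc_alg c)
  mc_mulA mulDl mulDr mulZl mulZr.

Definition cornerA (a : A) : mc_alg c := ((a, 0), (0, 0)).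
Definition cornerB (b : B) : mc_alg c := ((0, 0), (0, b)).

End ContextAlgebra.

Definition morita_equivalent (H : hopfType k) (A B : nualgType k)
    (actA : paction H A) (actB : paction H B) : Prop :=
  exists c : morita_context A B,
    [/\ strict_mc c, unital (mcM c), unital (mcN c) &
      exists actC : paction H (mc_alg c),
        (forall h a, actC h (cornerA c a) = cornerA c (actA h a)) /\
        (forall h b, actC h (cornerB c b) = cornerB c (actB h b))].

End Morita.

(* Main.v *)
From HB Require Import structures.
From mathcomp Require Import all_boot all_algebra.
Require Import Defs.

(* Morita equivalence of actions on A and B amounts to a Peirce decomposition:
   an H-algebra G, graded by pairs of indices like 2 x 2 matrices, whose
   diagonal entries are A and B and whose entries multiply onto one another.
   For the context algebra C, the action preserves the off-diagonal entries
   because M = AM = MB and N = BN = NA. An equivariant linear map f induces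
   u |-> f \o u between standard globalizations, so the projections of C onto
   its entries pass to the standard globalization of C and decompose it, with
   the globalizations of A and B on the diagonal. Its entries still multiply
   onto one another since h |> phi(xy) = \sum (h_1 |> phi(x)) * (h_2 |> phi(y)).
   *)

Set Implicit Arguments.
Unset Strict Implicit.
Unset Printing Implicit Defensive.

Import GRing.Theory.
Local Open Scope ring_scope.

(** * Peirce decompositions of an algebra with a partial action *)

Lemma pactM1 (k : fieldType) (H : hopfType k) (A : nualgType k)
    (act : paction H A) h (a b : A) :
  act h (a ** b) = \sum_(p <- sw h) act p.1 a ** act p.2 b.
Proof.
rewrite -[in LHS](pact1 act b) pactM.
by apply: eq_bigr => p _; rewrite mulr1.
Qed.

(* The index [false] stands for A and [true] for B, so [pcomp i j] is the
   projection of G onto its (i, j) entry. *)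
Record peirce (k : fieldType) (H : hopfType k) (R : bool -> nualgType k)
    (G : nualgType k) (actR : forall i, paction H (R i)) (actG : paction H G) :=
  Peirce {
  pcomp : bool -> bool -> {linear G -> G};
  pinj : forall i, {linear R i -> G};
  pprj : forall i, {linear G -> R i};
  pcompK : forall i j x, pcomp i j (pcomp i j x) = pcomp i j x;
  pcomp_orth : forall i j i' j' x, (i, j) != (i', j') ->
    pcomp i j (pcomp i' j' x) = 0;
  pcomp_sum : forall x, \sum_i \sum_j pcomp i j x = x;
  pcompM : forall i l x y,
    pcomp i l (x ** y) = \sum_j pcomp i j x ** pcomp j l y;
  pinjM : forall i a b, pinj i (a ** b) = pinj i a ** pinj i b;
  pinjK : forall i a, pprj i (pinj i a) = a;
  pprjK : forall i x, pinj i (pprj i x) = pcomp i i x;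
  pinj_act : forall i h a, pinj i (actR i h a) = actG h (pinj i a);
  (* Depending on i, j, l this says that M and N are unital on the left or on
     the right, or that the Morita context is strict. *)
  pcomp_span : forall i j l x, ~~ ((i == j) && (j == l)) ->
    exists s : seq (G * G),
      pcomp i l x = \sum_(p <- s) pcomp i j p.1 ** pcomp j l p.2
}.

(** * Compatibility of the action with the Peirce projections *)

Section PeirceTheory.
Context {k : fieldType} {H : hopfType k}.
Context {R : bool -> nualgType k} {G : nualgType k}.
Context {actR : forall i, paction H (R i)} {actG : paction H G}.
Variable P : peirce actR actG.
Implicit Types (i j l : bool) (x y : G).

Lemma pcomp_inj i a : pcomp P i i (pinj P i a) = pinj P i a.
Proof. by rewrite -pprjK pinjK. Qed.

Lemma pprj_comp i x : pprj P i (pcomp P i i x) = pprj P i x.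
Proof. by rewrite -pprjK pinjK. Qed.

Lemma pcomp_other i j i' j' x :
  pcomp P i j x = x -> (i', j') != (i, j) -> pcomp P i' j' x = 0.
Proof. by move=> <-; exact: pcomp_orth. Qed.

Lemma pcomp_mul i j l x y :
  pcomp P i j x = x -> pcomp P j l y = y -> pcomp P i l (x ** y) = x ** y.
Proof.
move=> xP yP; rewrite pcompM (bigD1 j) //= xP yP big1 ?addr0 // => j' j'j.
by rewrite (pcomp_other xP) ?linear0l // xpair_eqE (negPf j'j) andbF.
Qed.

Lemma pcomp_row i j i' l x y :
  pcomp P i j x = x -> i' != i -> pcomp P i' l (x ** y) = 0.
Proof.
move=> xP i'i; rewrite pcompM big1 // => j' _.
by rewrite (pcomp_other xP) ?linear0l // xpair_eqE (negPf i'i).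
Qed.

Lemma pcomp_col j l i l' x y :
  pcomp P j l y = y -> l' != l -> pcomp P i l' (x ** y) = 0.
Proof.
move=> yP l'l; rewrite pcompM big1 // => j' _.
by rewrite (pcomp_other yP) ?linear0r // xpair_eqE (negPf l'l) andbF.
Qed.

(** The (i, i) entry of [x] comes from [R i] through [pinj], which is equivariant. *)
Lemma act_comp_diag i h x :
  pcomp P i i (actG h (pcomp P i i x)) = actG h (pcomp P i i x).
Proof. by rewrite -(pprjK P i x) -pinj_act pcomp_inj. Qed.

(** An off-diagonal entry is a sum of products with a diagonal left factor, and also a sum of
    products with a diagonal right factor. Diagonal entries stay in place, so by [pactM1] the action
    changes neither the row nor the column. *)
Lemma pcomp_act_fixed i j h x :
  pcomp P i j (actG h (pcomp P i j x)) = actG h (pcomp P i j x).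
Proof.
case: (eqVneq i j) => [<-|ij]; first exact: act_comp_diag.
(* Left unitality: the entry is a sum of (i, i) times (i, j) products, and the left factor
   determines the row. *)
have row i' j' : i' != i -> pcomp P i' j' (actG h (pcomp P i j x)) = 0.
  move=> i'i; have [|s ->] := @pcomp_span _ _ _ _ _ _ P i i j x.
    by rewrite eqxx.
  rewrite linear_sumr linear_sum big1 // => p _.
  rewrite pactM1 linear_sum big1 // => q _.
  exact: pcomp_row (act_comp_diag _ _ _) i'i.
(* Right unitality: now the right factor is a (j, j) entry and determines the column. *)
have col i' j' : j' != j -> pcomp P i' j' (actG h (pcomp P i j x)) = 0.
  move=> j'j; have [|s ->] := @pcomp_span _ _ _ _ _ _ P i j j x.
    by rewrite eqxx andbT.
  rewrite linear_sumr linear_sum big1 // => p _.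
  rewrite pactM1 linear_sum big1 // => q _.
  exact: pcomp_col (act_comp_diag _ _ _) j'j.
rewrite -[RHS](pcomp_sum P) (bigD1 i) //=.
rewrite [X in _ = _ + X]big1 ?addr0 => [|i' i'i].
  by rewrite (bigD1 j) //= big1 ?addr0 // => j'; exact: col.
by rewrite big1 // => j' _; exact: row.
Qed.

(** Split [x] into its entries: the action keeps each in place, so only the (i, j) one survives the
    projection. *)
Lemma pcomp_act i j h x : pcomp P i j (actG h x) = actG h (pcomp P i j x).
Proof.
rewrite -[in LHS](pcomp_sum P x) linear_sumr linear_sum (bigD1 i) //=.
rewrite linear_sumr linear_sum (bigD1 j) //= pcomp_act_fixed.
rewrite !big1 ?addr0 // => [i' i'i|j' j'j].
  rewrite linear_sumr linear_sum big1 // => j' _.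
  rewrite (pcomp_other (pcomp_act_fixed _ _ _ _)) //.
  by rewrite xpair_eqE eq_sym (negPf i'i).
by rewrite (pcomp_other (pcomp_act_fixed _ _ _ _)) // xpair_eqE eqxx eq_sym j'j.
Qed.

Lemma pprj_act i h x : pprj P i (actG h x) = actR i h (pprj P i x).
Proof. by rewrite -pprj_comp pcomp_act -(pprjK P i x) -pinj_act pinjK. Qed.

End PeirceTheory.

(** * From a Peirce decomposition to a Morita equivalence *)

Section Corners.
Context {k : fieldType} {H : hopfType k}.
Context {R : bool -> nualgType k} {G : nualgType k}.
Context {actR : forall i, paction H (R i)} {actG : paction H G}.
Variable P : peirce actR actG.

Section CornerModule.
Variables i j : bool.

(** As [pcomp P i j] is idempotent, its fixed points form its image; an equation makes membership a
    boolean test. *)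
Definition corner_pred : {pred G} := fun x => pcomp P i j x == x.

Lemma corner_submod : GRing.submod_closed corner_pred.
Proof.
split=> [|c x y]; first by rewrite unfold_in linear0.
by rewrite !unfold_in linearP => /eqP -> /eqP ->.
Qed.
HB.instance Definition _ :=
  GRing.isSubmodClosed.Build k G corner_pred corner_submod.

Record corner := Corner { cval : G; _ : cval \in corner_pred }.
HB.instance Definition _ := [isSub for cval].
HB.instance Definition _ := [Choice of corner by <:].
HB.instance Definition _ := [SubChoice_isSubLmodule of corner by <:].

Lemma cvalK (m : corner) : pcomp P i j (cval m) = cval m.
Proof. exact/eqP/(valP m). Qed.

Lemma cval_inj : injective cval.
Proof. exact: val_inj. Qed.

Lemma cvalD (m n : corner) : cval (m + n) = cval m + cval n.
Proof. by []. Qed.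
Lemma cvalZ c (m : corner) : cval (c *: m) = c *: cval m.
Proof. by []. Qed.

Lemma cval_sum I (r : seq I) (F : I -> corner) :
  cval (\sum_(p <- r) F p) = \sum_(p <- r) cval (F p).
Proof. exact: (raddf_sum val). Qed.

Lemma pcomp_corner x : pcomp P i j x \in corner_pred.
Proof. by rewrite unfold_in pcompK. Qed.

Definition to_corner x : corner := Corner (pcomp_corner x).

Lemma to_corner_linear : linear to_corner.
Proof. by move=> c x y; apply/val_inj; exact: linearP. Qed.
HB.instance Definition _ :=
  GRing.isLinear.Build k G corner *:%R to_corner to_corner_linear.

(** The product already lies in the corner, see [corner_lactE]; [to_corner] only supplies the
    type. *)
Definition corner_lact (a : R i) (m : corner) : corner :=
  to_corner (pinj P i a ** cval m).
Definition corner_ract (b : R j) (m : corner) : corner :=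
  to_corner (cval m ** pinj P j b).

Lemma corner_lactE a m : cval (corner_lact a m) = pinj P i a ** cval m.
Proof. by rewrite /= (pcomp_mul (pcomp_inj P a) (cvalK m)). Qed.
Lemma corner_ractE b m : cval (corner_ract b m) = cval m ** pinj P j b.
Proof. by rewrite /= (pcomp_mul (cvalK m) (pcomp_inj P b)). Qed.

Lemma corner_lact_linear_r a : linear (corner_lact a).
Proof.
by move=> c m n; rewrite /= /corner_lact cvalD cvalZ linearPr linearP.
Qed.
Lemma corner_ract_linear_r b : linear (corner_ract b).
Proof.
by move=> c m n; rewrite /= /corner_ract cvalD cvalZ linearPl linearP.
Qed.

Definition corner_lactL a : {linear corner -> corner} := HB.pack (corner_lact a)
  (GRing.isLinear.Build k corner corner *:%R (corner_lact a)
     (corner_lact_linear_r a)).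
Definition corner_ractL b : {linear corner -> corner} := HB.pack (corner_ract b)
  (GRing.isLinear.Build k corner corner *:%R (corner_ract b)
     (corner_ract_linear_r b)).

Lemma corner_lact_linear m : linear (corner_lactL^~ m).
Proof. by move=> c a b; rewrite /= /corner_lact linearP linearPl linearP. Qed.
Lemma corner_ract_linear m : linear (corner_ractL^~ m).
Proof. by move=> c a b; rewrite /= /corner_ract linearP linearPr linearP. Qed.

Lemma corner_lactM a a' m :
  corner_lactL (a ** a') m = corner_lactL a (corner_lactL a' m).
Proof.
by apply: cval_inj; rewrite !corner_lactE pinjM nmulA.
Qed.
Lemma corner_ractM b b' m :
  corner_ractL (b ** b') m = corner_ractL b' (corner_ractL b m).
Proof.
by apply: cval_inj; rewrite !corner_ractE pinjM nmulA.
Qed.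
Lemma corner_lact_ract a b m :
  corner_ractL b (corner_lactL a m) = corner_lactL a (corner_ractL b m).
Proof.
by apply: cval_inj; rewrite corner_ractE !corner_lactE corner_ractE nmulA.
Qed.
HB.instance Definition _ := Lmodule_isBimodule.Build k (R i) (R j) corner
  corner_lact_linear corner_ract_linear corner_lactM corner_ractM
  corner_lact_ract.

Lemma lact_cornerE a (m : corner) : cval (a •l m) = pinj P i a ** cval m.
Proof. exact: corner_lactE. Qed.
Lemma ract_cornerE b (m : corner) : cval (m •r b) = cval m ** pinj P j b.
Proof. exact: corner_ractE. Qed.

Lemma corner_unital : i != j -> unital corner.
Proof.
move=> ij; split=> m.
- have [|s mE] := @pcomp_span _ _ _ _ _ _ P i i j (cval m).
    by rewrite eqxx.
  (* The left factors are (i, i) entries, hence act as elements of [R i]; [pprjK] recovers the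
     entries. *)
  exists [seq (pprj P i p.1, to_corner p.2) | p <- s]; apply: cval_inj.
  rewrite big_map cval_sum -cvalK mE; apply: eq_bigr => p _.
  by rewrite lact_cornerE pprjK.
- have [|s mE] := @pcomp_span _ _ _ _ _ _ P i j j (cval m).
    by rewrite eqxx andbT.
  exists [seq (to_corner p.1, pprj P j p.2) | p <- s]; apply: cval_inj.
  rewrite big_map cval_sum -cvalK mE; apply: eq_bigr => p _.
  by rewrite ract_cornerE pprjK.
Qed.
End CornerModule.

Section Pairing.
Variables i j : bool.

(** An (i, j) entry times a (j, i) entry is an (i, i) entry, so [pprj] loses nothing. The two orders
    of the indices give $\tau$ and $\sigma$. *)
Definition pairing (m : corner i j) (n : corner j i) : R i :=
  pprj P i (cval m ** cval n).

Lemma inj_pairing m n : pinj P i (pairing m n) = cval m ** cval n.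
Proof. by rewrite pprjK (pcomp_mul (cvalK m) (cvalK n)). Qed.

(** Allows identities between pairings to be checked in [G], where balancedness and the context
    axioms come down to associativity. *)
Lemma inj_inj : injective (pinj P i).
Proof. exact: (can_inj (pinjK P (i := i))). Qed.

Lemma pairing_bilinear : bilinear_for *:%R *:%R pairing.
Proof.
split=> [n|m] c u v; apply: inj_inj.
- by rewrite linearP !inj_pairing cvalD cvalZ linearPl.
- by rewrite linearP !inj_pairing cvalD cvalZ linearPr.
Qed.

Lemma pairing_bal m b n : pairing (m •r b) n = pairing m (b •l n).
Proof.
by apply: inj_inj; rewrite !inj_pairing ract_cornerE lact_cornerE nmulA.
Qed.

Definition pairingL : {linear tensB (corner i j) (corner j i) -> R i} :=
  HB.pack (tlift pairing : tensB (corner i j) (corner j i) -> R i)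
    (GRing.isLinear.Build k (tensB (corner i j) (corner j i)) (R i) *:%R _
      (tlift_linear pairing_bilinear pairing_bal)).

Lemma inj_pairingL m n :
  pinj P i (pairingL (tenspure m n)) = cval m ** cval n.
Proof.
rewrite -inj_pairing; congr (pinj P i _).
exact: (tlift_pure pairing_bilinear pairing_bal).
Qed.

(** This is the case of [pcomp_span] that goes from [i] to [j] and back; it yields strictness. *)
Lemma pairingL_surj : i != j -> forall a, exists x, pairingL x = a.
Proof.
move=> ij a; have [|s aE] := @pcomp_span _ _ _ _ _ _ P i j i (pinj P i a).
  by rewrite (negPf ij).
exists (\sum_(p <- s) tenspure (to_corner i j p.1) (to_corner j i p.2)).
apply: inj_inj; rewrite (raddf_sum pairingL) linear_sum -pcomp_inj aE.
by apply: eq_bigr => p _; exact: inj_pairingL.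
Qed.
End Pairing.

Section CornerContext.
Variables i j : bool.

Lemma pairingL_l a (m : corner i j) (n : corner j i) :
  pairingL i j (tenspure (a •l m) n) = a ** pairingL i j (tenspure m n).
Proof. by apply: inj_inj; rewrite pinjM !inj_pairingL lact_cornerE nmulA. Qed.

Lemma pairingL_r (m : corner i j) (n : corner j i) a :
  pairingL i j (tenspure m (n •r a)) = pairingL i j (tenspure m n) ** a.
Proof. by apply: inj_inj; rewrite pinjM !inj_pairingL ract_cornerE nmulA. Qed.

Lemma pairingL_assoc (m m' : corner i j) (n : corner j i) :
  pairingL i j (tenspure m n) •l m' = m •r pairingL j i (tenspure n m').
Proof.
by apply: cval_inj; rewrite lact_cornerE ract_cornerE !inj_pairingL nmulA.
Qed.
End CornerContext.

Definition corner_mc : morita_context (R false) (R true) := MoritaContext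
  (@pairingL_l false true) (@pairingL_r false true)
  (@pairingL_l true false) (@pairingL_r true false)
  (fun m n m' => @pairingL_assoc false true m m' n)
  (fun n m n' => @pairingL_assoc true false n n' m).

(** With its inverse [of_mc], this identifies [G] with the context algebra of its corners, along
    which the action is then transported. *)
Definition to_mc (x : G) : mc_alg corner_mc :=
  ((pprj P false x, to_corner false true x),
   (to_corner true false x, pprj P true x)).

Definition of_mc (u : mc_alg corner_mc) : G :=
  pinj P false u.1.1 + cval u.1.2 + (cval u.2.1 + pinj P true u.2.2).

Lemma to_mc_linear : linear to_mc.
Proof. by move=> c x y; rewrite /to_mc !linearP. Qed.

Lemma to_mcK x : of_mc (to_mc x) = x.
Proof.
rewrite /of_mc /= !pprjK -[RHS](pcomp_sum P) !big_bool /= addrC.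
by rewrite [_ + pcomp P _ _ _]addrC [X in _ = _ + X]addrC.
Qed.

Lemma pcomp_of_mc i j u : pcomp P i j (of_mc u) =
  match i, j with
  | false, false => pinj P false u.1.1
  | false, true => cval u.1.2
  | true, false => cval u.2.1
  | true, true => pinj P true u.2.2
  end.
Proof.
rewrite /of_mc -(pcomp_inj P u.1.1) -(pcomp_inj P u.2.2) -(cvalK u.1.2).
rewrite -(cvalK u.2.1) !linearD /=.
case: i j => -[]; by rewrite !pcompK !pcomp_orth // ?add0r ?addr0.
Qed.

Lemma of_mcK u : to_mc (of_mc u) = u.
Proof.
rewrite /to_mc -(pprj_comp P false) -(pprj_comp P true) !pcomp_of_mc !pinjK.
case: u => -[a m] [n b]; congr ((_, _), (_, _)); apply: cval_inj => /=.
  exact: (pcomp_of_mc false true ((a, m), (n, b))).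
exact: (pcomp_of_mc true false ((a, m), (n, b))).
Qed.

Lemma of_mc_linear : linear of_mc.
Proof.
move=> c u v; apply: (can_inj to_mcK).
by rewrite of_mcK to_mc_linear !of_mcK.
Qed.

HB.instance Definition _ :=
  GRing.isLinear.Build k G (mc_alg corner_mc) *:%R to_mc to_mc_linear.
HB.instance Definition _ :=
  GRing.isLinear.Build k (mc_alg corner_mc) G *:%R of_mc of_mc_linear.

(** Entry by entry this is [pcompM]; [addrC] intervenes because [big_bool] lists the index [true]
    first, matrix multiplication [false]. *)
Lemma to_mcM x y : to_mc (x ** y) = to_mc x ** to_mc y.
Proof.
congr ((_, _), (_, _)).
- apply: inj_inj; rewrite linearD /= pinjM inj_pairingL !pprjK pcompM.
  rewrite big_bool /=; exact: addrC.
- apply: cval_inj.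
  rewrite cvalD lact_cornerE ract_cornerE !pprjK /= pcompM big_bool /=.
  exact: addrC.
- apply: cval_inj.
  rewrite cvalD lact_cornerE ract_cornerE !pprjK /= pcompM big_bool /=.
  exact: addrC.
- apply: inj_inj; rewrite linearD /= pinjM inj_pairingL !pprjK pcompM.
  rewrite big_bool /=; exact: addrC.
Qed.

Definition mc_act (h : H) (u : mc_alg corner_mc) : mc_alg corner_mc :=
  to_mc (actG h (of_mc u)).

Lemma mc_act_bilinear : bilinear_for *:%R *:%R mc_act.
Proof.
split=> [u|h] c x y /=; rewrite /mc_act.
  by rewrite linearPl; exact: to_mc_linear.
by rewrite of_mc_linear linearPr; exact: to_mc_linear.
Qed.

Lemma mc_act1 u : mc_act 1 u = u.
Proof. by rewrite /mc_act pact1 of_mcK. Qed.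

Lemma of_mcM (u v : mc_alg corner_mc) : of_mc (u ** v) = of_mc u ** of_mc v.
Proof. by rewrite -{1}(of_mcK u) -{1}(of_mcK v) -to_mcM to_mcK. Qed.

Lemma mc_actM h g (u v : mc_alg corner_mc) : mc_act h (u ** mc_act g v) =
  \sum_(p <- sw h) mc_act p.1 u ** mc_act (p.2 * g) v.
Proof.
apply: (can_inj of_mcK).
rewrite /mc_act (raddf_sum of_mc) of_mcM !to_mcK pactM.
by apply: eq_bigr => p _; rewrite [RHS]of_mcM !to_mcK.
Qed.

Definition mc_paction : paction H (mc_alg corner_mc) :=
  @PAction k H (mc_alg corner_mc) (bilin_of mc_act_bilinear) mc_act1 mc_actM.

Lemma of_cornerA a : of_mc (cornerA corner_mc a) = pinj P false a.
Proof. by rewrite /of_mc /= linear0 !addr0. Qed.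

Lemma of_cornerB b : of_mc (cornerB corner_mc b) = pinj P true b.
Proof. by rewrite /of_mc /= linear0 !add0r. Qed.

Lemma peirce_morita : morita_equivalent (actR false) (actR true).
Proof.
exists corner_mc; split; [|exact: corner_unital|exact: corner_unital|].
  by split; exact: pairingL_surj.
(* Under [of_mc] the diagonal corners become the images of [pinj], so both restrictions follow from
   [pinj_act]. *)
exists mc_paction; split=> h a; apply: (can_inj of_mcK).
  by rewrite to_mcK !of_cornerA pinj_act.
by rewrite to_mcK !of_cornerB pinj_act.
Qed.

End Corners.

(** * Generators of the standard globalization *)

Section Glob.
Context {k : fieldType} {H : hopfType k} {A : nualgType k}.
Variable act : paction H A.

Lemma globP (u v : glob act) :
  (forall h, gval u h = gval v h) -> u = v.
Proof. by move=> uv; apply/val_inj/homP. Qed.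

Lemma glob_sumE I (r : seq I) (F : I -> glob act) h :
  gval (\sum_(p <- r) F p) h = \sum_(p <- r) gval (F p) h.
Proof.
have -> : gval (\sum_(p <- r) F p) = \sum_(p <- r) gval (F p).
  exact: (raddf_sum val).
exact: hom_sumE.
Qed.

Lemma glob_mulE (u v : glob act) h :
  gval (u ** v) h = \sum_(p <- sw h) gval u p.1 ** gval v p.2.
Proof. by []. Qed.

(** The generator $h \triangleright \varphi_A(a)$. *)
Definition gphi h a : glob act :=
  Glob (hact_phi_in act h a).

Lemma gphi_sum h I (r : seq I)
  (F : I -> A) : gphi h (\sum_(p <- r) F p) = \sum_(p <- r) gphi h (F p).
Proof.
by apply: globP => l; rewrite glob_sumE /= linear_sumr.
Qed.

(** $\varphi_A$ is multiplicative for convolution by [pactM1], and $\triangleright$ distributes over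
    products by [hactM]. *)
Lemma gphi_mul h (a b : A) :
  gphi h (a ** b) = \sum_(p <- sw h) gphi p.1 a ** gphi p.2 b.
Proof.
apply/val_inj; rewrite raddf_sum /= -hactM; congr hact.
by apply/homP => l; rewrite phiE pactM1.
Qed.

Lemma gphi_span (u : glob act) :
  exists s : seq (H * A), u = \sum_(p <- s) gphi p.1 p.2.
Proof.
by have /glob_predP[s us] := valP u; exists s; apply/val_inj; rewrite raddf_sum.
Qed.

End Glob.

(** * Functoriality of the globalization for equivariant linear maps *)

Section GlobMap.
Context {k : fieldType} {H : hopfType k} {X Y : nualgType k}.
Variables (actX : paction H X) (actY : paction H Y) (f : {linear X -> Y}).
Hypothesis f_act : forall h x, f (actX h x) = actY h (f x).

Lemma hom_comp_linear (u : Hom H X) : linear (fun h => f (u h)).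
Proof. by move=> c g h; rewrite !linearP. Qed.

Definition hom_comp (u : Hom H X) : Hom H Y := mkHom (hom_comp_linear u).

(** By equivariance $h \triangleright \varphi(x)$ goes to $h \triangleright \varphi(f(x))$. Linear
    maps are the right generality, since Peirce projections need not be multiplicative. *)
Lemma hom_comp_glob u : u \in glob_pred actX -> hom_comp u \in glob_pred actY.
Proof.
move=> /glob_predP[s ->]; apply/glob_predP; exists [seq (p.1, f p.2) | p <- s].
apply/homP => h; rewrite big_map /= !hom_sumE linear_sum.
by apply: eq_bigr => p _; rewrite !hactE !phiE.
Qed.

Definition glob_fun (u : glob actX) : glob actY :=
  Glob (hom_comp_glob (valP u)).

Lemma glob_funE u h : gval (glob_fun u) h = f (gval u h).
Proof. by []. Qed.

Lemma glob_fun_linear : linear glob_fun.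
Proof. by move=> c u v; apply/val_inj/homP => h; exact: linearP. Qed.

Definition glob_map : {linear glob actX -> glob actY} := HB.pack glob_fun
  (GRing.isLinear.Build k (glob actX) (glob actY) *:%R _ glob_fun_linear).

End GlobMap.

(** * Peirce decomposition of the globalization *)

Section GlobPeirce.
Context {k : fieldType} {H : hopfType k}.
Context {R : bool -> nualgType k} {G : nualgType k}.
Context {actR : forall i, paction H (R i)} {actG : paction H G}.
Variable P : peirce actR actG.

Definition gcomp i j := glob_map (@pcomp_act _ _ _ _ _ _ P i j).
Definition ginj i := glob_map (@pinj_act _ _ _ _ _ _ P i).
Definition gprj i := glob_map (@pprj_act _ _ _ _ _ _ P i).

Lemma gcomp_phi i j h x :
  gcomp i j (gphi actG h x) = gphi actG h (pcomp P i j x).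
Proof. by apply: globP => l; exact: pcomp_act. Qed.

Lemma gcomp_span i j l x : ~~ ((i == j) && (j == l)) ->
  exists s : seq (glob actG * glob actG),
    gcomp i l x = \sum_(p <- s) gcomp i j p.1 ** gcomp j l p.2.
Proof.
move=> ijl; have [s ->] := gphi_span x; elim: s => [|[h a] s [t IH]].
  by exists [::]; rewrite !big_nil linear0.
have [r aE] := pcomp_span P a ijl.
(* For the generator given by [h] and [a], split the (i, l) entry of [a] into the products listed in
   [r], then distribute [h] over each by [gphi_mul]. The projections of the factors are restored by
   [gcomp_phi]. *)
exists (flatten [seq [seq (gphi actG p.1 q.1, gphi actG p.2 q.2) | p <- sw h]
                  | q <- r] ++ t).
rewrite big_cons linearD IH big_cat /=; congr (_ + _).
rewrite [LHS]gcomp_phi aE gphi_sum big_flatten big_map; apply: eq_bigr => q _.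
rewrite gphi_mul big_map; apply: eq_bigr => p _.
by congr (_ ** _); symmetry; exact: gcomp_phi.
Qed.

(** The maps act on values, so the identities for projections and products are checked at each
    argument and reduce to those of [P]. *)
Lemma glob_peirce : peirce (fun i => glob_act (actR i)) (glob_act actG).
Proof.
apply: (@Peirce _ _ _ _ _ _ gcomp ginj gprj) => *.
- by apply: globP => h; exact: pcompK.
- by apply: globP => h; exact: pcomp_orth.
- apply: globP => h; rewrite glob_sumE -[RHS](pcomp_sum P).
  by apply: eq_bigr => i _; rewrite glob_sumE.
- apply: globP => h; rewrite glob_sumE glob_funE glob_mulE linear_sum.
  rewrite exchange_big /=; by apply: eq_bigr => p _; rewrite pcompM.
- apply: globP => h; rewrite glob_mulE !glob_funE glob_mulE linear_sum.
  by apply: eq_bigr => p _; rewrite pinjM.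
- by apply: globP => h; exact: pinjK.
- by apply: globP => h; exact: pprjK.
(* Equivariance of [ginj]: $\triangleright$ translates the argument while [ginj] acts on the value,
   so the two commute by computation. *)
- by apply: globP => h.
- exact: gcomp_span.
Qed.
End GlobPeirce.

(** * Vanishing rules for products of matrices with zero entries *)

Section BimoduleZero.
Context {k : fieldType} {A B C : nualgType k}.

Lemma lact0 (M : bimodType A B) (m : M) : (0 : A) •l m = 0.
Proof.
by have := lact_linear m (-1) 0 0; rewrite scaler0 addr0 scaleN1r addNr.
Qed.

Lemma ract0 (M : bimodType A B) (m : M) : m •r (0 : B) = 0.
Proof.
by have := ract_linear m (-1) 0 0; rewrite scaler0 addr0 scaleN1r addNr.
Qed.

Lemma tenspure0l (M : bimodType A B) (N : bimodType B C) (n : N) :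
  tenspure (0 : M) n = 0.
Proof. by rewrite /tenspure -(scale0r 0) pureZl scale0r. Qed.

Lemma tenspure0r (M : bimodType A B) (N : bimodType B C) (m : M) :
  tenspure m (0 : N) = 0.
Proof. by rewrite /tenspure -(scale0r 0) pureZr scale0r. Qed.
End BimoduleZero.

(** * Peirce decomposition of the context algebra *)

Section MoritaPeirce.
Context {k : fieldType} {H : hopfType k} {A B : nualgType k}.
Variables (actA : paction H A) (actB : paction H B) (c : morita_context A B).
Variable actC : paction H (mc_alg c).
Hypotheses (c_strict : strict_mc c) (M_unital : unital (mcM c)).
Hypothesis (N_unital : unital (mcN c)).
Hypothesis actC_A : forall h a, actC h (cornerA c a) = cornerA c (actA h a).
Hypothesis actC_B : forall h b, actC h (cornerB c b) = cornerB c (actB h b).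

Definition mc_comp (i j : bool) (x : mc_alg c) : mc_alg c :=
  match i, j with
  | false, false => ((x.1.1, 0), (0, 0))
  | false, true => ((0, x.1.2), (0, 0))
  | true, false => ((0, 0), (x.2.1, 0))
  | true, true => ((0, 0), (0, x.2.2))
  end.

Lemma mc_linE a (x y : mc_alg c) : a *: x + y =
  ((a *: x.1.1 + y.1.1, a *: x.1.2 + y.1.2),
   (a *: x.2.1 + y.2.1, a *: x.2.2 + y.2.2)).
Proof. by []. Qed.

Lemma mc_comp_linear i j : linear (mc_comp i j).
Proof.
by case: i j => -[] a x y; rewrite [RHS]mc_linE /= ?scaler0 ?addr0.
Qed.
HB.instance Definition _ i j :=
  GRing.isLinear.Build k (mc_alg c) (mc_alg c) *:%R _ (mc_comp_linear i j).

Lemma cornerA_linear : linear (cornerA c).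
Proof. by move=> a x y; rewrite [RHS]mc_linE /= ?scaler0 ?addr0. Qed.
HB.instance Definition _ :=
  GRing.isLinear.Build k A (mc_alg c) *:%R _ cornerA_linear.
Lemma cornerB_linear : linear (cornerB c).
Proof. by move=> a x y; rewrite [RHS]mc_linE /= ?scaler0 ?addr0. Qed.
HB.instance Definition _ :=
  GRing.isLinear.Build k B (mc_alg c) *:%R _ cornerB_linear.

Definition mc_prA (x : mc_alg c) : A := x.1.1.
Definition mc_prB (x : mc_alg c) : B := x.2.2.
Lemma mc_prA_linear : linear mc_prA.
Proof. by move=> a x y. Qed.
Lemma mc_prB_linear : linear mc_prB.
Proof. by move=> a x y. Qed.
HB.instance Definition _ :=
  GRing.isLinear.Build k (mc_alg c) A *:%R _ mc_prA_linear.
HB.instance Definition _ :=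
  GRing.isLinear.Build k (mc_alg c) B *:%R _ mc_prB_linear.

(** Puts [A] and [B] into one family over [bool], as [peirce] requires. *)
Definition diag_alg (i : bool) : nualgType k := if i then B else A.

Definition diag_act i : paction H (diag_alg i) :=
  if i return paction H (diag_alg i) then actB else actA.

Definition diag_inj i : {linear diag_alg i -> mc_alg c} :=
  if i return {linear diag_alg i -> mc_alg c} then cornerB c else cornerA c.
Definition diag_prj i : {linear mc_alg c -> diag_alg i} :=
  if i return {linear mc_alg c -> diag_alg i} then mc_prB else mc_prA.

Lemma mc_mulE (x y : mc_alg c) : x ** y =
  ((x.1.1 ** y.1.1 + mtau c (tenspure x.1.2 y.2.1),
    x.1.1 •l y.1.2 + x.1.2 •r y.2.2),
   (x.2.1 •r y.1.1 + x.2.2 •l y.2.1,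
    msigma c (tenspure x.2.1 y.1.2) + x.2.2 ** y.2.2)).
Proof. by case: x y => -[a m] [n b] [[a' m'] [n' b']]. Qed.

Definition mc_simp :=
  (@linear0l, @linear0r, @linear0, @lact0, @ract0, @tenspure0l, @tenspure0r,
   @addr0, @add0r).

Lemma mc_addE (x y : mc_alg c) : x + y =
  ((x.1.1 + y.1.1, x.1.2 + y.1.2), (x.2.1 + y.2.1, x.2.2 + y.2.2)).
Proof. by []. Qed.

Lemma mc_compM i l x y :
  mc_comp i l (x ** y) = \sum_j mc_comp i j x ** mc_comp j l y.
Proof.
rewrite big_bool [RHS]mc_addE !mc_mulE.
by case: i l => -[] /=; rewrite !mc_simp // addrC.
Qed.

Definition cornerM (m : mcM c) : mc_alg c := ((0, m), (0, 0)).
Definition cornerN (n : mcN c) : mc_alg c := ((0, 0), (n, 0)).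

Lemma cornerMD : {morph cornerM : x y / x + y}.
Proof. by move=> x y; rewrite [RHS]mc_addE /= !addr0. Qed.
Lemma cornerND : {morph cornerN : x y / x + y}.
Proof. by move=> x y; rewrite [RHS]mc_addE /= !addr0. Qed.

(** The six cases use, in order: N = BN, surjectivity of $\sigma$, N = NA, M = MB, surjectivity of
    $\tau$, M = AM. *)
Lemma mc_comp_span i j l x : ~~ ((i == j) && (j == l)) ->
  exists s : seq (mc_alg c * mc_alg c),
    mc_comp i l x = \sum_(p <- s) mc_comp i j p.1 ** mc_comp j l p.2.
Proof.
case: i j l => [] [] [] //= _.
- have [s nE] := N_unital.1 x.2.1.
  exists [seq (cornerB c p.1, cornerN p.2) | p <- s].
  rewrite nE big_map -/(cornerN _) (big_morph cornerN cornerND erefl).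
  by apply: eq_bigr => p _; rewrite mc_mulE /= !mc_simp.
- have [t bE] := c_strict.2 x.2.2.
  (* A formal sum of pure tensors representing the preimage [t] provides the factors. *)
  exists [seq (cornerN p.1, cornerM p.2) | p <- repr t].
  rewrite -bE -[in LHS](sum_repr_btens t) big_map -/(cornerB c _) !linear_sum.
  by apply: eq_bigr => p _; rewrite mc_mulE /= !mc_simp.
- have [s nE] := N_unital.2 x.2.1.
  exists [seq (cornerN p.1, cornerA c p.2) | p <- s].
  rewrite nE big_map -/(cornerN _) (big_morph cornerN cornerND erefl).
  by apply: eq_bigr => p _; rewrite mc_mulE /= !mc_simp.
- have [s mE] := M_unital.2 x.1.2.
  exists [seq (cornerM p.1, cornerB c p.2) | p <- s].
  rewrite mE big_map -/(cornerM _) (big_morph cornerM cornerMD erefl).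
  by apply: eq_bigr => p _; rewrite mc_mulE /= !mc_simp.
- have [t aE] := c_strict.1 x.1.1.
  exists [seq (cornerM p.1, cornerN p.2) | p <- repr t].
  rewrite -aE -[in LHS](sum_repr_btens t) big_map -/(cornerA c _) !linear_sum.
  by apply: eq_bigr => p _; rewrite mc_mulE /= !mc_simp.
- have [s mE] := M_unital.1 x.1.2.
  exists [seq (cornerA c p.1, cornerM p.2) | p <- s].
  rewrite mE big_map -/(cornerM _) (big_morph cornerM cornerMD erefl).
  by apply: eq_bigr => p _; rewrite mc_mulE /= !mc_simp.
Qed.

Lemma diag_injM i a b : diag_inj i (a ** b) = diag_inj i a ** diag_inj i b.
Proof. by case: i a b => a b; rewrite mc_mulE /= !mc_simp. Qed.

Lemma mc_comp_sum x : \sum_i \sum_j mc_comp i j x = x.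
Proof.
rewrite !big_bool; case: x => -[a m] [n b].
by congr ((_, _), (_, _)) => /=; rewrite ?addr0 ?add0r.
Qed.

Lemma mc_peirce : peirce diag_act actC.
Proof.
apply: (@Peirce _ _ _ _ _ _ mc_comp diag_inj diag_prj).
- by case=> -[].
- by move=> [] [] [] [].
- exact: mc_comp_sum.
- exact: mc_compM.
- exact: diag_injM.
- by case.
- by case.
(* Condition (2) of Morita equivalence enters here, on the two diagonal corners. *)
- by case=> h a; [rewrite /= actC_B|rewrite /= actC_A].
- exact: mc_comp_span.
Qed.

End MoritaPeirce.

Theorem theorem87 (k : fieldType) (H : hopfType k) (A B : nualgType k)
    (actA : paction H A) (actB : paction H B)
    (symA : symmetrical actA) (symB : symmetrical actB)
    (AB : morita_equivalent actA actB) :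
  morita_equivalent (glob_act actA) (glob_act actB).
Proof.
have [c [cs Mu Nu [actC [CA CB]]]] := AB.
(* At [false] and [true] the family [diag_act] computes to [actA] and [actB], so the globalized
   decomposition has the required diagonal. *)
exact: peirce_morita (glob_peirce (mc_peirce cs Mu Nu CA CB)).
Qed.
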